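(* Let $X$ be an extended quasi-metric space containing an adjacent pair $(x,y)$. Then the magnitude cohomology ring $\mathrm{MH}^*_*(X)$ is not graded-commutative.
   Context: An extended quasi-metric space is a set $X$ with a function $d\colon X\times X\to[0,\infty]$ such that $d(a,b)=0$ if and only if $a=b$, and $d(a,c)\leq d(a,b)+d(b,c)$ for all $a,b,c$ (symmetry and finiteness of $d$ are not required). A pair $(x,y)$ of elements of $X$ is adjacent if $d(x,y)$ is nonzero and finite, and for every $a\in X$, $d(x,y)=d(x,a)+d(a,y)$ implies $a=x$ or $a=y$. A $k$-simplex ($k\ge 0$) in $X$ is a tuple $(x_0,\ldots,x_k)\in X^{k+1}$ with $x_{i-1}\neq x_i$ for all $i$; its length is $\ell(x_0,\ldots,x_k)=d(x_0,x_1)+\cdots+d(x_{k-1},x_k)$. For $\ell\in[0,\infty)$, $\mathrm{MC}_{k,\ell}(X)$ is the free abelian group on the $k$-simplices of length $\ell$, with differential $\partial=\sum_{i=1}^{k-1}(-1)^i\partial_i\colon \mathrm{MC}_{k,\ell}(X)\to\mathrm{MC}_{k-1,\ell}(X)$, where $\partial_i(x_0,\ldots,x_k)=(x_0,\ldots,\widehat{x_i},\ldots,x_k)$ if $d(x_{i-1},x_{i+1})=d(x_{i-1},x_i)+d(x_i,x_{i+1})$ and $0$ otherwise. The magnitude cochain complex is $\mathrm{MC}^k_\ell(X)=\mathrm{Hom}(\mathrm{MC}_{k,\ell}(X),\mathbb{Z})$ with differential $\partial^*\varphi=\varphi\circ\partial$, and $\mathrm{MH}^k_\ell(X)=H^k(\mathrm{MC}^*_\ell(X))$.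 For $\varphi\in\mathrm{MC}^{k_1}_{\ell_1}(X)$ and $\psi\in\mathrm{MC}^{k_2}_{\ell_2}(X)$, the product $\varphi\cdot\psi\in\mathrm{MC}^{k_1+k_2}_{\ell_1+\ell_2}(X)$ sends a simplex $(x_0,\ldots,x_{k_1+k_2})$ of length $\ell_1+\ell_2$ to $\varphi(x_0,\ldots,x_{k_1})\,\psi(x_{k_1},\ldots,x_{k_1+k_2})$ if $\ell(x_0,\ldots,x_{k_1})=\ell_1$ and $\ell(x_{k_1},\ldots,x_{k_1+k_2})=\ell_2$, and to $0$ otherwise. The unit is the cochain $u\in\mathrm{MC}^0_0(X)$ with $u(x_0)=1$ for every $0$-simplex. This satisfies the Leibniz rule and makes $\mathrm{MH}^*_*(X)$ into an associative unital bigraded ring, the magnitude cohomology ring of $X$. Graded-commutative means $\alpha\cdot\beta=(-1)^{k_1k_2}\beta\cdot\alpha$ for all $\alpha\in\mathrm{MH}^{k_1}_{\ell_1}(X)$, $\beta\in\mathrm{MH}^{k_2}_{\ell_2}(X)$. *)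

(* Defs.v *)
From HB Require Import structures.
From mathcomp Require Import all_boot all_order all_algebra.
From mathcomp Require Import boolp reals constructive_ereal.
From mathcomp Require Import zify freeg.

Set Implicit Arguments.
Unset Strict Implicit.
Unset Printing Implicit Defensive.

Import Order.TTheory GRing.Theory Num.Theory.

Local Open Scope ring_scope.
Local Open Scope quotient_scope.

Record extQuasiMetric (R : realType) := ExtQuasiMetric {
  qm_carrier :> Type;
  qdist : qm_carrier -> qm_carrier -> \bar R;
  qdist_ge0 : forall a b, (0 <= qdist a b)%E;
  qdist_eq0 : forall a b, qdist a b = 0%E <-> a = b;
  qdist_triangle : forall a b c, (qdist a c <= qdist a b + qdist b c)%E
}.

HB.instance Definition _ (R : realType) (X : extQuasiMetric R) :=
  gen_eqMixin (qm_carrier X).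
HB.instance Definition _ (R : realType) (X : extQuasiMetric R) :=
  gen_choiceMixin (qm_carrier X).

Definition adjacent (R : realType) (X : extQuasiMetric R) (x y : X) : Prop :=
  [/\ qdist x y <> 0%E, (qdist x y < +oo)%E
    & forall a : X, qdist x y = (qdist x a + qdist a y)%E -> a = x \/ a = y].

Section Magnitude.
Context {R : realType} {X : extQuasiMetric R}.
Implicit Types (s : seq X) (k : nat) (l : R).

Local Notation d := (@qdist R X).

Definition len s : \bar R :=
  if s is x :: s' then (\sum_(e <- pairmap d x s') e)%E else 0%E.

Definition is_simplex k l s : bool :=
  [&& size s == k.+1, sorted (fun a b => a != b) s & len s == l%:E].

Record simplex k l := Simplex {
  vertices :> seq X;
  _ : is_simplex k l vertices
}.
HB.instance Definition _ k l := [isSub for (@vertices k l)].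
HB.instance Definition _ k l := [Choice of simplex k l by <:].

Definition chain k l := {freeg (simplex k l) / int}.
HB.instance Definition _ k l := GRing.Lmodule.on (chain k l).

(* The condition on the vertices x_(i-1), x_i, x_(i+1), for 0 < i < size s - 1. *)
Definition between i s : bool :=
  if drop i.-1 s is [:: a, b, c & _] then d a c == (d a b + d b c)%E else false.

Definition omit i s : seq X := take i s ++ drop i.+1 s.

Lemma len_cons2 a b s : len [:: a, b & s] = (d a b + len (b :: s))%E.
Proof. by rewrite /len /= big_cons. Qed.

Lemma len1 a : len [:: a] = 0%E.
Proof. by rewrite /len /= big_nil. Qed.

Lemma len_cat s a t : len (s ++ a :: t) = (len (rcons s a) + len (a :: t))%E.
Proof.
elim: s => [|x [|y s] IHs]; first by rewrite [rcons _ _]/= len1 add0e.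
  by rewrite [rcons _ _]/= !len_cons2 len1 adde0.
by rewrite !cat_cons !rcons_cons !len_cons2 -rcons_cons -addeA -IHs.
Qed.

Lemma betweenP i s : (0 < i)%N -> between i s ->
  exists p a b c t, [/\ s = p ++ [:: a, b, c & t],
    omit i s = p ++ [:: a, c & t] & d a c = (d a b + d b c)%E].
Proof.
case: i => // i _; rewrite /between /=.
case E: (drop i s) => [|a [|b [|c t]]] // /eqP dE.
exists (take i s), a, b, c, t; split => //; first by rewrite -E cat_take_drop.
have -> : omit i.+1 s = take i s ++ a :: drop i.+2 s.
  have lt_is : (i < size s)%N by rewrite ltnNge -subn_eq0 -size_drop E.
  rewrite /omit (take_nth a lt_is) -cats1 -catA; congr (_ ++ _ :: _).
  by rewrite -[i]addn0 -nth_drop E.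
by rewrite -addn2 addnC -drop_drop E.
Qed.

Lemma len_omit i s : (0 < i)%N -> between i s -> len (omit i s) = len s.
Proof.
move=> i0 /(betweenP i0)[p [a [b [c [t [-> -> dE]]]]]].
by rewrite !len_cat !len_cons2 dE !addeA.
Qed.

Lemma omit_sorted i s : (0 < i)%N -> between i s ->
  sorted (fun a b => a != b) s -> sorted (fun a b => a != b) (omit i s).
Proof.
move=> i0 /(betweenP i0)[p [a [b [c [t [-> -> dE]]]]]].
rewrite !sorted_cat_cons /= => /and4P[-> ab _ ->]; rewrite andbT /=.
apply/eqP => ac; move/eqP: ab; apply; apply/qdist_eq0/eqP.
have := dE; rewrite ac (qdist_eq0 c c).2 // => /esym/eqP.
by rewrite padde_eq0 ?qdist_ge0 // => /andP[].
Qed.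

Lemma omit_simplex k l i s : (0 < i)%N ->
  is_simplex k.+1 l s -> between i s -> is_simplex k l (omit i s).
Proof.
move=> i0 /and3P[sz srt /eqP ln] bi; apply/and3P; split; last 2 first.
- exact: omit_sorted.
- by rewrite len_omit // ln.
have [p [a [b [c [t [sE -> _]]]]]] := betweenP i0 bi.
by move: sz; rewrite sE !size_cat /= !addnS eqSS.
Qed.

(* insub never fails here, by omit_simplex. *)
Definition face k l i (sigma : simplex k.+1 l) : chain k l :=
  if between i sigma then
    oapp (fun tau : simplex k l => << tau >>) 0 (insub (omit i sigma))
  else 0.

Definition boundary k l : chain k.+1 l -> chain k l :=
  fglift (fun sigma : simplex k.+1 l =>
            \sum_(1 <= i < k.+1) (-1) ^+ i *: face i sigma).

HB.instance Definition _ k l :=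
  GRing.isZmodMorphism.Build (chain k.+1 l) (chain k l) (@boundary k l)
    (lift_is_additive _).

Definition cochain k l := {additive chain k l -> int}.
HB.instance Definition _ k l := gen_eqMixin (cochain k l).
HB.instance Definition _ k l := gen_choiceMixin (cochain k l).

Identity Coercion additive_of_cochain : cochain >-> Algebra.Additive.type.

Section CochainZmodule.
Variables (k : nat) (l : R).
Implicit Types phi psi : cochain k l.

Lemma cochainP phi psi : phi =1 psi -> phi = psi.
Proof.
case: phi psi => f [[hf]] [g [[hg]]] /= /funext fg.
case: g / fg hg => hg; congr (Algebra.Additive.Pack (Algebra.Additive.Class _)).
by congr Algebra.isNmodMorphism.Axioms_; apply: Prop_irrelevance.
Qed.

Definition cochain0 : cochain k l := \0%R.
Definition cochain_add phi psi : cochain k l :=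
  GRing.add_fun (phi : {additive _ -> _}) (psi : {additive _ -> _}).
Definition cochain_opp phi : cochain k l :=
  GRing.opp_fun (phi : {additive _ -> _}).

Lemma cochain_addA : associative cochain_add.
Proof. by move=> f g h; apply: cochainP => x; apply: addrA. Qed.
Lemma cochain_addC : commutative cochain_add.
Proof. by move=> f g; apply: cochainP => x; apply: addrC. Qed.
Lemma cochain_add0 : left_id cochain0 cochain_add.
Proof. by move=> f; apply: cochainP => x; apply: add0r. Qed.
Lemma cochain_addN : left_inverse cochain0 cochain_opp cochain_add.
Proof. by move=> f; apply: cochainP => x; apply: addNr. Qed.

HB.instance Definition _ := GRing.isZmodule.Build (cochain k l)
  cochain_addA cochain_addC cochain_add0 cochain_addN.
End CochainZmodule.

Definition cobd k l (phi : cochain k l) : cochain k.+1 l :=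
  phi \o @boundary k l.

(* The value of a cochain on a tuple, extended by 0 to the tuples that are not
   k-simplices of length l. *)
Definition ev k l (phi : cochain k l) s : int :=
  oapp (fun sigma : simplex k l => phi << sigma >>) 0 (insub s).

Definition chain_lift k l (f : simplex k l -> int) : chain k l -> int :=
  fglift (f : simplex k l -> int^o).
HB.instance Definition _ k l (f : simplex k l -> int) :=
  GRing.isZmodMorphism.Build (chain k l) int (chain_lift f)
    (lift_is_additive (f : simplex k l -> int^o)).

Definition cochain_of k l (f : simplex k l -> int) : cochain k l :=
  chain_lift f.

Definition cup k1 k2 l1 l2 (phi : cochain k1 l1) (psi : cochain k2 l2) :
    cochain (k1 + k2) (l1 + l2) :=
  cochain_of (fun sigma => ev phi (take k1.+1 sigma) * ev psi (drop k1 sigma)).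

Section Evaluation.
Variables (k : nat) (l : R).

Lemma chainE (c : chain k l) : c = \sum_(t <- dom c) coeff t c *: << t >>.
Proof.
rewrite -{1}[c]freeg_sumE; apply: eq_bigr => t _.
by apply/eqP/freeg_eqP => u; rewrite coeffZ !coeffU mul1r.
Qed.

Lemma cochainZ (phi : cochain k l) n c : phi (n *: c) = n * phi c.
Proof. by rewrite -[n in LHS]intz scaler_int raddfMz mulrzz mulrC. Qed.

Lemma cochain_basisP (phi psi : cochain k l) :
  (forall t : simplex k l, phi << t >> = psi << t >>) -> phi = psi.
Proof.
move=> e; apply: cochainP => c; rewrite (chainE c) !raddf_sum.
by apply: eq_bigr => t _; rewrite !cochainZ e.
Qed.

Lemma cochain_ofE f (t : simplex k l) : cochain_of f << t >> = f t.
Proof. by rewrite /cochain_of /= /chain_lift liftU scale1r. Qed.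

Lemma evE (phi : cochain k l) (t : simplex k l) : ev phi t = phi << t >>.
Proof. by rewrite /ev valK. Qed.

Lemma ev0 (phi : cochain k l) s : ~~ is_simplex k l s -> ev phi s = 0.
Proof. by move=> nS; rewrite /ev insubN. Qed.

Lemma ev_cochain_of (f : seq X -> int) s : is_simplex k l s ->
  ev (cochain_of (fun t : simplex k l => f t)) s = f s.
Proof. by move=> S; rewrite /ev insubT /= -[LHS]/(cochain_of _ _) cochain_ofE. Qed.

Lemma evB (phi psi : cochain k l) s : ev (phi - psi) s = ev phi s - ev psi s.
Proof. by rewrite /ev; case: insubP => //= *; rewrite subr0. Qed.
End Evaluation.

(* The formula for cobd, on arbitrary functions of tuples. *)
Definition delta k (f : seq X -> int) s : int :=
  \sum_(1 <= i < k) (-1) ^+ i * (if between i s then f (omit i s) else 0).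

Lemma cobd_delta k l (phi : cochain k l) (t : simplex k.+1 l) :
  cobd phi << t >> = delta k.+1 (ev phi) t.
Proof.
rewrite /cobd /= /boundary liftU scale1r raddf_sum big_nat /delta big_nat.
apply: eq_bigr => i /andP[i0 _].
rewrite cochainZ; congr (_ * _); rewrite /face; case: ifP => [bi|_]; last exact: raddf0.
by rewrite /ev; case: insubP => //= *; rewrite raddf0.
Qed.

Lemma ev_cobd k l (phi : cochain k l) s :
  size s = k.+2 -> sorted (fun a b => a != b) s ->
  ev (cobd phi) s = delta k.+1 (ev phi) s.
Proof.
move=> sz srt; have [S|nS] := boolP (is_simplex k.+1 l s).
  by rewrite -[s]/(vertices (Simplex S)) evE cobd_delta.
rewrite ev0 //; symmetry; rewrite /delta big_nat big1 // => i /andP[i0 _].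
case: ifP => bi; last by rewrite mulr0.
rewrite ev0 ?mulr0 //; apply: contra nS => /and3P[_ _].
by rewrite (len_omit i0 bi) => ln; rewrite /is_simplex sz eqxx srt ln.
Qed.

Lemma omitS i x s : omit i.+1 (x :: s) = x :: omit i s.
Proof. by []. Qed.

Lemma omit_nil i : omit i [::] = [::].
Proof. by []. Qed.

Lemma omit0 x s : omit 0 (x :: s) = s.
Proof. by rewrite /omit /= drop0. Qed.

Lemma take_omit k i s : (i <= k)%N -> take k (omit i s) = omit i (take k.+1 s).
Proof.
elim: s k i => [|x s IHs] [|k] [|i] ik //;
  rewrite ?[take _.+1 (x :: s)]take_cons ?omitS ?omit0 ?take0 //.
by rewrite [LHS]/= IHs.
Qed.

Lemma drop_omit k i s : (i <= k)%N -> drop k (omit i s) = drop k.+1 s.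
Proof.
elim: s k i => [|x s IHs] [|k] [|i] ik //; rewrite ?omit0 ?drop0 /= ?drop0 //.
by rewrite -/(omit i s) IHs.
Qed.

Lemma between_take k i s : (0 < i < k)%N ->
  between i (take k.+1 s) = between i s.
Proof.
case: i => // i ik; rewrite /between /=.
have [m ->] : exists m, k.+1 = (m.+3 + i)%N by exists (k.+1 - i.+3)%N; lia.
by rewrite -take_drop; case: (drop i s) => [|a [|b [|c t]]].
Qed.

Lemma take_omitr k i s : (k <= i)%N -> take k (omit i s) = take k s.
Proof.
elim: s k i => [|x s IHs] [|k] [|i] ik //; rewrite ?take0 //.
by rewrite omitS !take_cons IHs.
Qed.

Lemma drop_omitr k i s : drop k (omit (k + i) s) = omit i (drop k s).
Proof.
by elim: s k => [|x s IHs] [|k] //; rewrite ?drop0 // addSn omitS /= IHs.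
Qed.

Lemma between_drop k i s : (0 < i)%N ->
  between (k + i) s = between i (drop k s).
Proof. by case: i => // i _; rewrite /between addnS drop_drop addnC. Qed.

Lemma leibniz k1 k2 (f g : seq X -> int) s  :
  delta (k1 + k2).+1 (fun s => f (take k1.+1 s) * g (drop k1 s)) s =
  delta k1.+1 f (take k1.+2 s) * g (drop k1.+1 s) +
  (-1) ^+ k1 * (f (take k1.+1 s) * delta k2.+1 g (drop k1 s)).
Proof.
rewrite /delta (@big_cat_nat _ _ _ k1.+1) //= ?ltnS ?leq_addr //.
congr (_ + _).
  rewrite mulr_suml big_nat [RHS]big_nat; apply: eq_bigr => i /andP[i0 ik].
  rewrite between_take ?i0 // -mulrA; congr (_ * _).
  case: ifP => _; last by rewrite mul0r.
  by rewrite take_omit 1?drop_omit // ltnW.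
pose F i := (-1) ^+ i *
  (if between i s then f (take k1.+1 (omit i s)) * g (drop k1 (omit i s))
   else 0).
have -> : \sum_(k1.+1 <= i < (k1 + k2).+1) F i = \sum_(1 <= j < k2.+1) F (j + k1)%N.
  by rewrite -[k1.+1]add1n big_addn; congr bigop; congr index_iota; lia.
rewrite /F !mulr_sumr big_nat [RHS]big_nat; apply: eq_bigr => j /andP[j0 jk].
rewrite addnC between_drop // exprD -mulrA; congr (_ * _).
rewrite drop_omitr take_omitr; last by lia.
by case: ifP => _; rewrite ?mulr0 // mulrCA.
Qed.

Lemma ev_cup k1 k2 l1 l2 (phi : cochain k1 l1) (psi : cochain k2 l2) s :
  is_simplex (k1 + k2) (l1 + l2) s ->
  ev (cup phi psi) s = ev phi (take k1.+1 s) * ev psi (drop k1 s).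
Proof.
exact: (@ev_cochain_of (k1 + k2) (l1 + l2)
  (fun s => ev phi (take k1.+1 s) * ev psi (drop k1 s)) s).
Qed.

Lemma cobd_cup k1 k2 l1 l2 (phi : cochain k1 l1) (psi : cochain k2 l2)
    (t : simplex (k1 + k2).+1 (l1 + l2)) :
  cobd (cup phi psi) << t >> =
  ev (cobd phi) (take k1.+2 t) * ev psi (drop k1.+1 t) +
  (-1) ^+ k1 * (ev phi (take k1.+1 t) * ev (cobd psi) (drop k1 t)).
Proof.
have S : is_simplex (k1 + k2).+1 (l1 + l2) t := valP t.
have /and3P[/eqP sz srt _] := S.
have st : size (take k1.+2 t) = k1.+2 by rewrite size_takel // sz !ltnS leq_addr.
have sd : size (drop k1 t) = k2.+2 by rewrite size_drop sz -addnS -addnS addKn.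
rewrite cobd_delta (ev_cobd _ st) ?take_sorted // (ev_cobd _ sd) ?drop_sorted //.
rewrite -leibniz // /delta big_nat [RHS]big_nat.
apply: eq_bigr => i /andP[i0 _]; congr (_ * _); case: ifP => // bi.
by rewrite ev_cup // (omit_simplex i0 S).
Qed.

Section Cohomology.
Variables (k : nat) (l : R).

Definition cocycles : {pred cochain k l} := [pred phi | cobd phi == 0].

Lemma cocyclesP phi : reflect (forall s, ev (cobd phi) s = 0) (phi \in cocycles).
Proof.
apply: (iffP eqP) => [-> s|e].
  by rewrite /ev; case: insubP.
by apply: cochain_basisP => t; rewrite -[LHS]evE e.
Qed.

Lemma cobdB (phi psi : cochain k l) : cobd (phi - psi) = cobd phi - cobd psi.
Proof. exact: cochainP. Qed.

Fact cocycles_zmod_closed : zmod_closed cocycles.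
Proof.
split=> [|phi psi]; first by apply/eqP/cochainP.
by rewrite !inE cobdB => /eqP-> /eqP->; rewrite subrr.
Qed.
HB.instance Definition _ :=
  GRing.isZmodClosed.Build (cochain k l) cocycles cocycles_zmod_closed.

Record cocycle := Cocycle {
  cocycle_val :> cochain k l;
  _ : cocycle_val \in cocycles
}.
HB.instance Definition _ := [isSub for cocycle_val].
HB.instance Definition _ := [Choice of cocycle by <:].
HB.instance Definition _ := [SubChoice_isSubZmodule of cocycle by <:].
End Cohomology.

(* There are no cochains of degree -1. *)
Definition is_coboundary k l : cochain k l -> Prop :=
  match k with
  | 0 => fun phi => phi = 0
  | n.+1 => fun phi => exists chi : cochain n l, phi = cobd chi
  end.

Definition coboundaries k l : {pred cocycle k l} :=
  fun z => `[< is_coboundary (cocycle_val z) >].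

Fact coboundaries_zmod_closed k l : zmod_closed (@coboundaries k l).
Proof.
split=> [|z w]; rewrite ?unfold_in.
  apply/asboolP; case: k => [|k] //=; exists 0; exact: cochainP.
move=> /asboolP hz /asboolP hw; apply/asboolP; move: z w hz hw.
case: k => [|k] z w /=; first by move=> -> ->; rewrite subrr.
by move=> [x ->] [y ->]; exists (x - y); rewrite cobdB.
Qed.
HB.instance Definition _ k l := GRing.isZmodClosed.Build (cocycle k l)
  (@coboundaries k l) (coboundaries_zmod_closed k l).

Definition MH k l := Quotient.quot (@coboundaries k l).
HB.instance Definition _ k l := GRing.Zmodule.on (MH k l).

Fact cup_cocycle k1 k2 l1 l2 (phi : cocycle k1 l1) (psi : cocycle k2 l2) :
  cup phi psi \in @cocycles (k1 + k2) (l1 + l2).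
Proof.
have /cocyclesP hphi := valP phi; have /cocyclesP hpsi := valP psi.
apply/eqP/cochain_basisP => t; rewrite cobd_cup hphi hpsi.
by rewrite mul0r !mulr0 addr0.
Qed.

Definition cocycle_cup k1 k2 l1 l2 (phi : cocycle k1 l1) (psi : cocycle k2 l2) :
    cocycle (k1 + k2) (l1 + l2) :=
  Cocycle (cup_cocycle phi psi).

Definition MH_class k l (z : cocycle k l) : MH k l := \pi_(MH k l) z.

(* Independent of the representatives: see MH_mul_class below. *)
Definition MH_mul k1 k2 l1 l2 (a : MH k1 l1) (b : MH k2 l2) :
    MH (k1 + k2) (l1 + l2) :=
  MH_class (cocycle_cup (repr a) (repr b)).

Lemma MH_classP k l (z w : cocycle k l) :
  MH_class z = MH_class w <-> is_coboundary (cocycle_val z - cocycle_val w).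
Proof.
split.
  by move=> /eqP; rewrite /MH_class -Quotient.idealrBE => /asboolP.
by move=> h; apply/eqP; rewrite /MH_class -Quotient.idealrBE; apply/asboolP.
Qed.

Lemma coboundary_delta k n l (phi : cochain k l) (f : seq X -> int) :
  k = n.+1 -> (forall t : simplex k l, phi << t >> = delta k f t) ->
  is_coboundary phi.
Proof.
case: k phi => // k phi [kn]; subst n => e.
exists (cochain_of (fun t : simplex k l => f t)).
apply: cochain_basisP => t; rewrite e cobd_delta /delta big_nat [RHS]big_nat.
apply: eq_bigr => i /andP[i0 _]; congr (_ * _); case: ifP => // bi.
by rewrite ev_cochain_of // (omit_simplex i0 _ bi) //; exact: (valP t).
Qed.

Lemma is_coboundaryD k l (phi psi : cochain k l) :
  is_coboundary phi -> is_coboundary psi -> is_coboundary (phi + psi).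
Proof.
case: k phi psi => [|k] phi psi /=; first by move=> -> ->; rewrite addr0.
move=> [x ->] [y ->]; exists (x + y); exact: cochainP.
Qed.

Lemma cupE k1 k2 l1 l2 (phi : cochain k1 l1) (psi : cochain k2 l2)
    (t : simplex (k1 + k2) (l1 + l2)) :
  cup phi psi << t >> = ev phi (take k1.+1 t) * ev psi (drop k1 t).
Proof. exact: cochain_ofE. Qed.

Lemma cup0l k1 k2 l1 l2 (psi : cochain k2 l2) :
  cup (0 : cochain k1 l1) psi = 0.
Proof.
by apply: cochain_basisP => t; rewrite cupE {1}/ev; case: insubP; rewrite /= ?mul0r.
Qed.

Lemma cup0r k1 k2 l1 l2 (phi : cochain k1 l1) :
  cup phi (0 : cochain k2 l2) = 0.
Proof.
apply: cochain_basisP => t; rewrite cupE {2}/ev.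
by case: insubP; rewrite /= ?mulr0.
Qed.

Lemma cup_coboundaryl k1 k2 l1 l2 (phi : cochain k1 l1) (psi : cochain k2 l2) :
  is_coboundary phi -> psi \in @cocycles k2 l2 -> is_coboundary (cup phi psi).
Proof.
case: k1 phi => [|k1] phi /=.
  by move=> -> _; rewrite cup0l; case: k2 psi => //= k psi; exists 0; exact: cochainP.
move=> [chi ->] /cocyclesP hpsi.
exists (cup chi psi); apply: cochain_basisP => t.
by rewrite cobd_cup hpsi !mulr0 addr0 cupE.
Qed.

Lemma cup_coboundaryr k1 k2 l1 l2 (phi : cochain k1 l1) (psi : cochain k2 l2) :
  phi \in @cocycles k1 l1 -> is_coboundary psi -> is_coboundary (cup phi psi).
Proof.
move=> /cocyclesP hphi; case: k2 psi => [|k2] psi.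
  move=> /= ->; rewrite cup0r; case: (k1 + 0)%N => //= k.
  by exists 0; apply: cochainP.
move=> [chi ->]; pose f s := (-1) ^+ k1 * (ev phi (take k1.+1 s) * ev chi (drop k1 s)).
apply: (coboundary_delta (n := (k1 + k2)%N) (f := f)); first by rewrite addnS.
move=> t; have : is_simplex (k1 + k2.+1) (l1 + l2) t := valP t.
rewrite cupE; move: (vertices t) => s /and3P[/eqP sz srt _].
have st : size (take k1.+2 s) = k1.+2 by rewrite size_takel // sz; lia.
have sd : size (drop k1 s) = k2.+2 by rewrite size_drop sz; lia.
have := leibniz k1 k2 (ev phi) (ev chi) s.
rewrite -ev_cobd ?take_sorted // hphi mul0r add0r.
rewrite -ev_cobd ?drop_sorted // => /(congr1 (fun x => (-1) ^+ k1 * x)).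
rewrite mulrA -exprMn mulrNN mulr1 expr1n mul1r => <-.
rewrite addnS /delta mulr_sumr; apply: eq_bigr => i _.
by rewrite mulrCA; congr (_ * _); case: ifP => _; rewrite ?mulr0.
Qed.

Fact MH_mul_class k1 k2 l1 l2 (z : cocycle k1 l1) (w : cocycle k2 l2) :
  MH_mul (MH_class z) (MH_class w) = MH_class (cocycle_cup z w).
Proof.
rewrite /MH_mul; set z' := repr _; set w' := repr _.
have hz : is_coboundary (cocycle_val z' - cocycle_val z).
  by apply/MH_classP; rewrite /MH_class reprK.
have hw : is_coboundary (cocycle_val w' - cocycle_val w).
  by apply/MH_classP; rewrite /MH_class reprK.
apply/MH_classP; rewrite [X in is_coboundary X](_ : _ =
    cup (cocycle_val z' - cocycle_val z) w' +
    cup z (cocycle_val w' - cocycle_val w)).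
  apply: is_coboundaryD.
    exact: cup_coboundaryl hz (valP w').
  exact: cup_coboundaryr (valP z) hw.
apply: cochain_basisP => t.
rewrite -[LHS]/(cup z' w' << t >> - cup z w << t >>).
rewrite -[RHS]/(cup _ _ << t >> + cup _ _ << t >>).
by rewrite !cupE !evB mulrBl mulrBr addrA subrK.
Qed.

Definition MH_cast k k' l l' (ek : k = k') (el : l = l') (a : MH k l) : MH k' l' :=
  ecast j (MH j l') ek (ecast m (MH k m) el a).

End Magnitude.

Arguments MH {R} X k l.

(* Both sides live in the same bidegree only up to commutativity of addition,
   hence the transport. *)
Definition graded_commutative (R : realType) (X : extQuasiMetric R) : Prop :=
  forall (k1 k2 : nat) (l1 l2 : R), 0 <= l1 -> 0 <= l2 ->
  forall (a : MH X k1 l1) (b : MH X k2 l2),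
    MH_mul a b =
    MH_cast (addnC k2 k1) (addrC l2 l1) (MH_mul b a *~ (-1) ^+ (k1 * k2)).

(* Main.v *)
Require Import Defs.
From mathcomp Require Import all_boot all_order all_algebra.
From mathcomp Require Import reals constructive_ereal.

(** The cochain dual to a vertex already fails to commute with the cochain dual
    to an edge.  Write [e_x] for the 0-cochain dual to the tuple (x), and
    [e_xy] for the 1-cochain dual to (x, y), in length d(x, y).

    Both are cocycles.  The differential out of degree 0 is an empty alternating
    sum, so every 0-cochain is closed.  The coboundary of [e_xy] could be nonzero
    only on a simplex (x, a, y) with d(x, y) = d(x, a) + d(a, y); adjacency then
    makes [a] equal to one of its neighbours, which no simplex allows
    ([dual_edge_cocycle]).

    Splitting (x, y) after its first vertex gives [e_x . e_xy = e_xy], whereas in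
    [e_xy . e_x] the second factor is evaluated at [y <> x], so this product
    vanishes already as a cochain.  Since one of the degrees is 0, the sign in the
    commutation rule is trivial, and graded commutativity would make the class of
    [e_xy] zero.  But the only coboundary in degree 1 is 0, again because the
    differential out of degree 0 vanishes, and [e_xy] takes the value 1 on (x, y). *)

Set Implicit Arguments.
Unset Strict Implicit.
Unset Printing Implicit Defensive.

Import Order.TTheory GRing.Theory Num.Theory.
Local Open Scope ring_scope.

Section DualCochains.
Context {R : realType} {X : extQuasiMetric R}.
Implicit Types (k : nat) (l : R) (s : seq X).

Lemma cobd_deg0 l (phi : @cochain R X 0 l) : cobd phi = 0.
Proof. by apply: cochain_basisP => t; rewrite cobd_delta /delta big_geq. Qed.

Lemma cochain0_cocycle l (phi : @cochain R X 0 l) : phi \in @cocycles R X 0 l.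
Proof. by rewrite inE cobd_deg0. Qed.

Definition dual_cochain k l s : @cochain R X k l :=
  cochain_of (fun t : simplex k l => (vertices t == s)%:R).

Lemma ev_dual k l s s' :
  ev (dual_cochain k l s) s' = (is_simplex k l s' && (s' == s))%:R.
Proof.
have [S|nS] := boolP (is_simplex k l s'); last by rewrite ev0.
by rewrite (ev_cochain_of (fun s' => (s' == s)%:R)).
Qed.

Lemma is_simplex1 l (a : X) : is_simplex 0 l [:: a] = (l == 0).
Proof. by rewrite /is_simplex len1 /= eq_sym. Qed.

Lemma is_simplex2 l (a b : X) :
  is_simplex 1 l [:: a; b] = (a != b) && (qdist a b == l%:E).
Proof. by rewrite /is_simplex len_cons2 len1 adde0 /= andbT. Qed.

Lemma adjacent_neq (x y : X) : adjacent x y -> x != y.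
Proof. by case=> d0 _ _; apply/eqP => /qdist_eq0. Qed.

Lemma adjacent_fine (x y : X) :
  adjacent x y -> (fine (qdist x y))%:E = qdist x y.
Proof. by case=> _ dfin _; rewrite fineK // ge0_fin_numE // qdist_ge0. Qed.

(** Only simplices (x, a, y) with [a] between [x] and [y] have (x, y) as a face,
    and adjacency rules them out. *)
Lemma dual_edge_cocycle l (x y : X) :
  adjacent x y -> dual_cochain 1 l [:: x; y] \in @cocycles R X 1 l.
Proof.
move=> [_ _ adj]; apply/eqP/cochain_basisP => t; rewrite cobd_delta.
have : is_simplex 2 l t := valP t; case: (vertices t) => [|a [|b [|c []]]] // /and3P[_ srt _].
rewrite /delta big_nat1; case: ifP => [bt|_]; last by rewrite mulr0.
rewrite ev_dual; case: andP => [[_ /eqP[ax cy]]|_]; last by rewrite mulr0.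
move: bt srt; rewrite /between /= ax cy => /eqP /adj.
by case=> ->; rewrite eqxx ?andbF.
Qed.

Lemma MH_class0 k l : MH_class (0 : cocycle k l) = 0 :> MH X k l.
Proof. exact: raddf0. Qed.

Lemma MH_cast0 k k' l l' (ek : k = k') (el : l = l') :
  MH_cast ek el (0 : MH X k l) = 0.
Proof. by case: k' / ek; case: l' / el. Qed.

End DualCochains.

Theorem proposition2p3 (R : realType) (X : extQuasiMetric R) (x y : X)
    (hxy : adjacent x y) :
  ~ graded_commutative X.
Proof.
have neq_xy := adjacent_neq hxy; have dE := adjacent_fine hxy.
set l := fine (qdist x y) in dE; have l_ge0 : 0 <= l by rewrite fine_ge0 ?qdist_ge0.
pose z := Cocycle (cochain0_cocycle (dual_cochain 0 0 [:: x])).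
pose w := Cocycle (dual_edge_cocycle l hxy).
have wz0 : cocycle_cup w z = 0.
  apply/val_inj/cochain_basisP => t; rewrite cupE !ev_dual -natrM mulnb.
  have /and3P[/eqP sz _ _] : is_simplex (1 + 0) (l + 0) t := valP t.
  rewrite take_oversize ?sz //.
  (* On (x, y), the remaining tuple after the edge is (y), not (x). *)
  case: andP => [[/andP[_ /eqP ->]]|//].
  by rewrite /= eqseq_cons eq_sym (negPf neq_xy) andbF.
move=> /(_ 0%N 1%N 0 l (lexx 0) l_ge0 (MH_class z) (MH_class w)).
rewrite !MH_mul_class wz0 MH_class0 mul0rz MH_cast0 -MH_class0.
(* The degree 0 + 1 is convertible to 1, so a coboundary here is [cobd chi] with
   [chi] of degree 0, hence zero. *)
move=> /MH_classP[chi]; rewrite cobd_deg0 subr0 => zw0.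
have S : is_simplex 1 (0 + l) [:: x; y] by rewrite is_simplex2 neq_xy add0r dE /=.
have := ev_cup (dual_cochain 0 0 [:: x]) (dual_cochain 1 l [:: x; y]) S.
rewrite !ev_dual /= is_simplex1 is_simplex2 neq_xy dE !eqxx mulr1.
have -> : cup (dual_cochain 0 0 [:: x]) (dual_cochain 1 l [:: x; y]) = 0 := zw0.
by rewrite /ev insubT.
Qed.
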